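(* In the prescribed-archive setting described in the context, for even integers $T\ge4$, $r\in(0,1]$, and $0<\epsilon\le T/512$, $$\mathcal M_{\rm cov}^*(T,\epsilon,r)>\frac{T^3}{46137344\,r\,\epsilon^2}.$$
   Context: Lost-sales inventory model. Horizon $T$; $u^+=\max\{u,0\}$. Demands $D_1,\ldots,D_T$ are independent with laws $P_t$ supported on $[0,\bar D]$; $F_t^-(u)=\mathbb P(D_t<u)$. Holding and shortage coefficients $h_t,p_t>0$ are known, $C_c=\max_t\max\{h_t,p_t\}$; fixed and per-unit ordering costs, lead time, and terminal salvage value are zero. Starting period $t$ with inventory $x_t\ge0$, the retailer chooses a post-order level $y_t\ge x_t$ before demand and incurs $h_t(y_t-D_t)^++p_t(D_t-y_t)^+$. The next state is $(y_t-D_t)^+$; only sales $\min\{D_t,y_t\}$ are observed. Feasible policies use the information then available and may randomize; $V_1^\pi(x)$ is the expected total cost from initial inventory $x$, and $V_1^*(x)=\inf_\pi V_1^\pi(x)$. A policy $\pi$ is $\epsilon$-optimal at $x$ if $V_1^\pi(x)-V_1^*(x)\le\epsilon$. Prescribed-archive setting. Normalize $C_c=\bar D=1$ and $x_1=0$. For each positive integer $N$, the learner is supplied with $N$ raw sales logs per period, $(Z_t^j,b_t^j)$, $t=1,\ldots,T$, $j=1,\ldots,N$, where $b_t^j\ge0$ is a prescribed known boundary and $Z_t^j=\min\{D_t^j,b_t^j\}$, with $D_t^j$ latent. Conditional on the complete boundary array, the latent $D_t^j$ are mutually independent and $D_t^j$ has law $P_t$. The learner is also supplied with known nondecreasing caps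 $0\le a_t\le1$ satisfying $F_t^-(a_t)>p_t/(h_t+p_t)$ and $m_t:=|\{j:b_t^j\ge a_t\}|\ge\lceil rN\rceil$ for every $t$. The learner observes these arrays but cannot choose them; it knows the costs but not the demand laws, and may be randomized. $N_{\rm cov}^*(T,\epsilon,r)$ is the least $N$ permitting one learner to return a policy that is $\epsilon$-optimal at $x_1=0$ with probability at least $3/4$ (over data and learner randomization), uniformly over these demand laws, known costs, and arrays. Finally $\mathcal M_{\rm cov}^*(T,\epsilon,r)=T\,N_{\rm cov}^*(T,\epsilon,r)$. *)

(* Defs.v *)
From HB Require Import structures.
From mathcomp Require Import all_boot all_order all_algebra.
From mathcomp Require Import all_classical all_reals all_analysis.

Set Implicit Arguments.
Unset Strict Implicit.
Unset Printing Implicit Defensive.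

Import Order.TTheory GRing.Theory Num.Theory.
Import numFieldNormedType.Exports.

Local Open Scope classical_set_scope.
Local Open Scope ring_scope.

(* Throughout, the periods 1, ..., T are indexed by 'I_T = {0, ..., T-1}. *)

Section RandomVariables.
Context {R : realType} {d : measure_display} {Omega : measurableType d}.
Variable Pr : probability Omega R.

Definition has_law (X : {RV Pr >-> R}) (P : probability R R) : Prop :=
  forall A : set R, measurable A -> distribution Pr X A = P A.

(* The product rule for subfamilies is the case A i = setT. *)
Definition mutually_independent (I : finType) (X : I -> {RV Pr >-> R}) : Prop :=
  forall A : I -> set R, (forall i, measurable (A i)) ->
    Pr [set w | forall i, A i (X i w)] =
    (\prod_(i : I) Pr (X i @^-1` A i))%E.

End RandomVariables.

Section DemandLaws.
Context {R : realType}.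

Definition supported_on (P : probability R R) (Dbar : R) : Prop :=
  P [set` `[0, Dbar]] = 1%E.

Definition cdf_left (P : probability R R) (u : R) : \bar R :=
  P [set v | v < u].

End DemandLaws.

Section Policies.
Context {R : realType}.

Definition pos_part (u : R) : R := Num.max u 0.

(* What the retailer has observed before ordering in period t: the initial
   inventory and the pairs (post-order level, sales) of the t past periods. *)
Definition history (t : nat) : Type := (R * t.-tuple (R * R))%type.

(* Current inventory: the initial one if t = 0, and otherwise the last
   post-order level minus the last sales, y - min(D, y) = (y - D)^+. *)
Definition inventory (t : nat) (H : history t) : R :=
  let q := last (H.1, 0) H.2 in q.1 - q.2.

(* A randomized policy draws a seed independently of the demands, and then
   orders as a measurable function of the seed and of the observed history.
   Feasibility is imposed on all histories; this costs no generality, since a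
   rule can be replaced by its maximum with the inventory off the reachable
   histories. *)
Record policy (T : nat) := Policy {
  pol_disp : measure_display ;
  pol_seed : measurableType pol_disp ;
  pol_prob : probability pol_seed R ;
  pol_rule : forall t : 'I_T, pol_seed * (R * t.-tuple (R * R)) -> R ;
  pol_meas : forall t : 'I_T, measurable_fun setT (@pol_rule t) ;
  pol_feas : forall (t : 'I_T) (s : pol_seed) (H : history t),
    inventory H <= @pol_rule t (s, H) }.
Arguments pol_rule {T} p t : rename.
Arguments pol_meas {T} p t : rename.
Arguments pol_feas {T} p t s H : rename.

Section Trajectory.
Variables (T : nat) (pi : policy T) (x : R).
Variables (s : pol_seed pi) (D : 'I_T -> R).

Fixpoint past (t : nat) : (t <= T)%N -> t.-tuple (R * R) :=
  match t with
  | 0 => fun _ => [tuple]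
  | t'.+1 => fun lt_t'T =>
      let H := past (ltnW lt_t'T) in
      let i := Ordinal lt_t'T in
      let y := pol_rule pi i (s, (x, H)) in
      [tuple of rcons H (y, Num.min (D i) y)]
  end.

Definition order_level (t : 'I_T) : R :=
  pol_rule pi t (s, (x, past (ltnW (ltn_ord t)))).

Definition total_cost (h p : 'I_T -> R) : R :=
  \sum_(t < T) (h t * pos_part (order_level t - D t) +
                p t * pos_part (D t - order_level t)).

End Trajectory.

Section Value.
Variables (T : nat) (h p : 'I_T -> R).
Variables (d : measure_display) (Omega : measurableType d).
Variables (Pr : probability Omega R) (D : 'I_T -> {RV Pr >-> R}).

Definition value (pi : policy T) (x : R) : \bar R :=
  (\int[pol_prob pi \x Pr]_(w in setT)
     (total_cost x w.1 (fun t => D t w.2) h p)%:E)%E.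

Definition optimal_value (x : R) : \bar R :=
  ereal_inf [set v | exists pi : policy T, v = value pi x].

Definition eps_optimal (eps x : R) (pi : policy T) : Prop :=
  (value pi x - optimal_value x <= eps%:E)%E.

End Value.
End Policies.

Section PrescribedArchive.
Context {R : realType}.

(* The data handed to the learner as known, non-random quantities. *)
Record known (T N : nat) := Known {
  hold : 'I_T -> R ;
  short : 'I_T -> R ;
  cap : 'I_T -> R ;
  bound : 'I_T -> 'I_N -> R }.

Definition admissible_known (T N : nat) (r : R) (k : known T N) : Prop :=
  [/\ forall t, 0 < hold k t /\ 0 < short k t,
      \big[Num.max/0]_(t < T) Num.max (hold k t) (short k t) = 1,
      forall t, 0 <= cap k t <= 1,
      forall s t : 'I_T, (s <= t)%N -> cap k s <= cap k t &
      (forall t j, 0 <= bound k t j) /\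
      (forall t, Num.ceil (r * N%:R) <=
                 (#|[set j : 'I_N | cap k t <= bound k t j]%SET|)%:Z) ].

Definition admissible_laws (T N : nat) (k : known T N)
    (P : 'I_T -> probability R R) : Prop :=
  forall t, supported_on (P t) 1 /\
    ((short k t / (hold k t + short k t))%:E < cdf_left (P t) (cap k t))%E.

(* A learner for fixed known quantities, with an internal seed (est_seed)
   drawn before the policy is returned, and a separate seed (est_pol_seed) for
   the randomization of the returned policy. The rule is jointly measurable in
   the sales logs, both seeds and the history, so that the value of the
   returned policy is a random variable. *)
Record estimator (T N : nat) := Estimator {
  est_disp : measure_display ;
  est_seed : measurableType est_disp ;
  est_prob : probability est_seed R ;
  est_pol_disp : measure_display ;
  est_pol_seed : measurableType est_pol_disp ;
  est_pol_prob : probability est_pol_seed R ;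
  est_rule : forall t : 'I_T,
    (T.-tuple (N.-tuple R) * est_seed) *
    (est_pol_seed * (R * t.-tuple (R * R))) -> R ;
  est_meas : forall t : 'I_T, measurable_fun setT (@est_rule t) ;
  est_feas : forall (t : 'I_T) z s (H : history t),
    inventory H <= @est_rule t (z, (s, H)) }.
Arguments est_rule {T N} e t : rename.
Arguments est_meas {T N} e t : rename.
Arguments est_feas {T N} e t z s H : rename.

Section Returned.
Variables (T N : nat) (e : estimator T N).
Variable (z : T.-tuple (N.-tuple R) * est_seed e).

Lemma returned_meas (t : 'I_T) :
  measurable_fun setT (fun sH => est_rule e t (z, sH)).
Proof.
exact: (measurable_fun_pair2 z (est_meas e t)).
Qed.

Definition returned_policy : policy T :=
  @Policy R T _ _ (est_pol_prob e) (fun t sH => est_rule e t (z, sH))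
    returned_meas (fun t => est_feas e t z).

End Returned.

Definition learner (T N : nat) := known T N -> estimator T N.

Definition sales_logs (T N : nat) (b D : 'I_T -> 'I_N -> R) :
    T.-tuple (N.-tuple R) :=
  [tuple [tuple Num.min (D t j) (b t j) | j < N] | t < T].

(* (Omega, Pr, D) carries the demands faced by the returned policy, and
   (Omega', Pr', L) the latent demands behind the archive. *)
Definition learns (T N : nat) (eps r : R) (A : learner T N) : Prop :=
  forall (k : known T N) (P : 'I_T -> probability R R),
    admissible_known r k -> admissible_laws k P ->
  forall (d : measure_display) (Omega : measurableType d)
    (Pr : probability Omega R) (D : 'I_T -> {RV Pr >-> R}),
    mutually_independent D -> (forall t, has_law (D t) (P t)) ->
  forall (d' : measure_display) (Omega' : measurableType d')
    (Pr' : probability Omega' R) (L : 'I_T * 'I_N -> {RV Pr' >-> R}),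
    mutually_independent L -> (forall t j, has_law (L (t, j)) (P t)) ->
  ((3 / 4)%:E <=
    (Pr' \x est_prob (A k))
      [set w | eps_optimal (hold k) (short k) D eps 0
         (returned_policy
            (sales_logs (bound k) (fun t j => L (t, j) w.1), w.2))])%E.

(* +oo when no N is large enough. *)
Definition N_cov_star (T : nat) (eps r : R) : \bar R :=
  ereal_inf [set (N%:R)%:E | N in
    [set N : nat | (0 < N)%N /\ exists A : learner T N, learns eps r A]].

Definition M_cov_star (T : nat) (eps r : R) : \bar R :=
  ((T%:R)%:E * N_cov_star T eps r)%E.

End PrescribedArchive.

(* Main.v *)
Require Import Defs.
From HB Require Import structures.
From mathcomp Require Import all_boot all_order all_algebra.
From mathcomp Require Import all_classical all_reals all_analysis.
From mathcomp Require Import measurable_realfun zify ring lra.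

(** Take h = p = 1, caps 1, demands in {1/3, 2/3} with P(D_t = 2/3) =
    (1 + s_t a) / 2 for unknown signs s_t, and let only m = ceil (r N) logs per
    period be uncensored, the others having boundary 0.  Leftover stock never
    exceeds 1/3, so the optimal policy orders 2/3 or 1/3 according to the sign
    s_t, and any policy pays an excess of a/3 per period times the normalized
    distance of its clipped order to that level.  The order of period t depends
    on s_t only through the m informative logs of that period (Assouad), and a
    second-moment bound shows that these leave s_t undetermined as long as
    m a^2 is small.  Hence the expected loss, averaged over the signs, is at
    least about a T / 6, whereas success with probability 3/4 bounds it by
    eps + a T / 12; with a = 32 eps / T this forces r N of order T^2 / eps^2. *)

Set Implicit Arguments.
Unset Strict Implicit.
Unset Printing Implicit Defensive.

Import Order.TTheory GRing.Theory Num.Theory.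
Local Open Scope ring_scope.

(** * Biased independent bits *)

Section BiasedBits.
Context {R : realFieldType} {I : finType}.
Implicit Types (e : I -> R) (f : {ffun I -> bool}) (g : {ffun I -> bool} -> R).

Definition bsign (b : bool) : R := if b then 1 else -1.

(** The parameter [x] is the bias: the mean of [bsign b], with 0 for a fair bit. *)
Definition bit_prob (x : R) (b : bool) : R := (1 + bsign b * x) / 2.

Definition bits_prob e f : R := \prod_i bit_prob (e i) (f i).

Definition bits_mean e g : R := \sum_f bits_prob e f * g f.

Definition flip (i : I) f : {ffun I -> bool} :=
  [ffun j => if j == i then ~~ f j else f j].

Lemma bsignN b : bsign (~~ b) = - bsign b.
Proof. by case: b; rewrite /bsign ?opprK. Qed.

Lemma bit_probT x b : bit_prob x b + bit_prob x (~~ b) = 1.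
Proof. by rewrite /bit_prob bsignN; field. Qed.

Lemma bit_prob_ge0 x b : `|x| <= 1 -> 0 <= bit_prob x b.
Proof. by rewrite ler_norml /bit_prob /bsign => /andP[? ?]; case: b; lra. Qed.

Lemma bits_prob_ge0 e f : (forall i, `|e i| <= 1) -> 0 <= bits_prob e f.
Proof. by move=> he; apply: prodr_ge0 => i _; exact: bit_prob_ge0. Qed.

Lemma flipK i : involutive (flip i).
Proof. by move=> f; apply/ffunP => j; rewrite !ffunE; case: eqP; rewrite ?negbK. Qed.

Lemma flip_eq i f : flip i f i = ~~ f i.
Proof. by rewrite ffunE eqxx. Qed.

Lemma flip_neq i j f : j != i -> flip i f j = f j.
Proof. by rewrite ffunE => /negbTE ->. Qed.

Lemma sum_flip i (F : {ffun I -> bool} -> R) : \sum_f F (flip i f) = \sum_f F f.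
Proof. by rewrite [RHS](reindex_inj (inv_inj (flipK i))). Qed.

Lemma bits_prob_rem i e f :
  bits_prob e f = bit_prob (e i) (f i) * \prod_(j | j != i) bit_prob (e j) (f j).
Proof. by rewrite /bits_prob (bigD1 i). Qed.

Lemma bits_prob_flip i e f : bits_prob e (flip i f) =
  bit_prob (e i) (~~ f i) * \prod_(j | j != i) bit_prob (e j) (f j).
Proof.
by rewrite (bits_prob_rem i) flip_eq; congr (_ * _);
  apply: eq_bigr => j ji; rewrite flip_neq.
Qed.

Lemma bits_probD_flip i e f : bits_prob e f + bits_prob e (flip i f) =
  \prod_(j | j != i) bit_prob (e j) (f j).
Proof. by rewrite bits_prob_flip (bits_prob_rem i) -mulrDl bit_probT mul1r. Qed.

(** Redrawing bit [i] independently leaves the product law invariant: [f] and [flip i f] share every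
    factor of the weight except the one at [i]. *)
Lemma bits_mean_resample i e g : bits_mean e g =
  bits_mean e (fun f => bit_prob (e i) (f i) * g f
                      + bit_prob (e i) (~~ f i) * g (flip i f)).
Proof.
rewrite /bits_mean; under [RHS]eq_bigr do rewrite mulrDr.
rewrite big_split /= -[X in _ = _ + X](sum_flip i) -big_split /=.
apply: eq_bigr => f _; rewrite flipK flip_eq negbK.
rewrite -[LHS]mul1r -[X in X * _](bit_probT (e i) (f i)).
by rewrite bits_prob_flip (bits_prob_rem i); ring.
Qed.

(** Averaging over [f] and [flip i f] removes [e i] from the weight whenever [g] ignores bit [i], so
    the biases on [K] can be replaced one at a time. *)
Lemma bits_mean_irrelevant (K : pred I) e e' g :
  (forall i, ~~ K i -> e i = e' i) -> (forall i f, K i -> g (flip i f) = g f) ->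
  bits_mean e g = bits_mean e' g.
Proof.
move=> ee' gK.
have one_step i d d' : K i -> (forall j, j != i -> d j = d' j) ->
    bits_mean d g = bits_mean d' g.
  move=> Ki dd'.
  have half (c : I -> R) : bits_mean c g = 2^-1 * \sum_(f : {ffun I -> bool})
      (\prod_(j | j != i) bit_prob (c j) (f j)) * g f.
    transitivity (2^-1 * (bits_mean c g + bits_mean c g)); first by field.
    congr (_ * _).
    rewrite /bits_mean -[X in _ + X](sum_flip i) -big_split /=.
    by apply: eq_bigr => f _; rewrite gK// -mulrDl bits_probD_flip.
  rewrite !half; congr (_ * _); apply: eq_bigr => f _; congr (_ * _).
  by apply: eq_bigr => j ji; rewrite dd'.
have step (s : seq I) : all K s ->
    bits_mean e g = bits_mean (fun i => if i \in s then e' i else e i) g.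
  elim: s => [//|i s IH] /= /andP[Ki /IH ->].
  by apply: (one_step i) => // j /negbTE ji; rewrite inE ji.
rewrite (step (enum K)); last by apply/allP => i; rewrite mem_enum.
congr bits_mean; apply/funext => i; rewrite mem_enum /in_mem/=.
by case: ifPn => // /ee'.
Qed.

Lemma bits_mean_prod e (phi : I -> bool -> R) :
  bits_mean e (fun f => \prod_i phi i (f i)) =
  \prod_i (bit_prob (e i) true * phi i true + bit_prob (e i) false * phi i false).
Proof.
under [RHS]eq_bigr => i _ do rewrite -(big_bool _ (fun b => bit_prob (e i) b * phi i b)).
rewrite bigA_distr_bigA /=; apply: eq_bigr => f _.
by rewrite -big_split.
Qed.

Lemma bits_meanT e : \sum_f bits_prob e f = 1.
Proof.
transitivity (bits_mean e (fun f => \prod_(i : I) 1)).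
  by apply: eq_bigr => f _; rewrite big1 ?mulr1.
rewrite (bits_mean_prod e (fun _ _ => 1)) big1// => i _.
by rewrite !mulr1; exact: (bit_probT _ true).
Qed.

Lemma bits_mean_cst e c : bits_mean e (fun=> c) = c.
Proof. by rewrite /bits_mean -mulr_suml bits_meanT mul1r. Qed.

Lemma bits_meanD e g g' :
  bits_mean e (fun f => g f + g' f) = bits_mean e g + bits_mean e g'.
Proof. by rewrite /bits_mean -big_split; apply: eq_bigr => f _; rewrite mulrDr. Qed.

Lemma bits_meanZ e c g : bits_mean e (fun f => c * g f) = c * bits_mean e g.
Proof. by rewrite /bits_mean mulr_sumr; apply: eq_bigr => f _; rewrite mulrCA. Qed.

Lemma bits_mean_1B e g : bits_mean e (fun f => 1 - g f) = 1 - bits_mean e g.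
Proof.
rewrite -[X in _ = X - _](bits_mean_cst e 1) /bits_mean -sumrB.
by apply: eq_bigr => f _; rewrite mulrBr.
Qed.

Lemma bits_mean_sum e (J : finType) (G : J -> {ffun I -> bool} -> R) :
  bits_mean e (fun f => \sum_j G j f) = \sum_j bits_mean e (G j).
Proof.
rewrite /bits_mean exchange_big; apply: eq_bigr => f _; exact: mulr_sumr.
Qed.

Lemma ler_bits_mean e g g' : (forall i, `|e i| <= 1) -> (forall f, g f <= g' f) ->
  bits_mean e g <= bits_mean e g'.
Proof.
by move=> he gg'; apply: ler_sum => f _; rewrite ler_wpM2l// bits_prob_ge0.
Qed.

(* Second-moment method: both laws are densities [L], [L'] with respect to the
   law with unbiased bits on [J], and [`|L' - L| <= 1/8 + 2 (L' - L)^2]. *)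
Lemma bits_mean_indist (J : {set I}) (a : R) e e' g :
  (forall i, i \in J -> e i = a /\ e' i = - a) ->
  (forall i, i \notin J -> e i = e' i) ->
  (forall i, `|e i| <= 1) -> (forall f, 0 <= g f <= 1) ->
  bits_mean e' g - bits_mean e g <=
    1 / 8 + 4 * ((1 + a ^+ 2) ^+ #|J| - (1 - a ^+ 2) ^+ #|J|).
Proof.
move=> eJ eNJ he hg.
pose e0 i := if i \in J then 0 else e i.
pose phi (c : R) i b := if i \in J then 1 + bsign b * c else 1.
pose L c f := \prod_i phi c i (f i).
have he0 i : `|e0 i| <= 1 by rewrite /e0; case: ifP; rewrite ?normr0.
have dens c d : (forall i, i \in J -> d i = c) ->
    (forall i, i \notin J -> d i = e i) ->
    forall f, bits_prob d f = bits_prob e0 f * L c f.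
  move=> dJ dNJ f; rewrite /bits_prob /L -big_split /=; apply: eq_bigr => i _.
  rewrite /bit_prob /e0 /phi; case: (boolP (i \in J)) => iJ.
    by rewrite dJ// mulr0 addr0; field.
  by rewrite dNJ// mulr1.
(* Bits in [J] are fair under [e0], so the linear terms vanish and each contributes a factor
   [1 + c * d]. *)
have LL c d : bits_mean e0 (fun f => L c f * L d f) = (1 + c * d) ^+ #|J|.
  transitivity (bits_mean e0 (fun f => \prod_i (phi c i (f i) * phi d i (f i)))).
    by apply: eq_bigr => f _; rewrite big_split.
  rewrite (bits_mean_prod e0 (fun i b => phi c i b * phi d i b)).
  rewrite -prodr_const [RHS]big_mkcond /=; apply: eq_bigr => i _.
  rewrite /phi /bit_prob /e0 /bsign; case: ifP => _; first by field.
  by field.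
have -> : bits_mean e' g - bits_mean e g =
    bits_mean e0 (fun f => g f * (L (- a) f - L a f)).
  rewrite /bits_mean -sumrB; apply: eq_bigr => f _.
  rewrite (dens (- a) e') ?(dens a e)//; first by ring.
  - by move=> i /eJ[].
  - by move=> i /eJ[].
  - by move=> i /eNJ.
apply: (@le_trans _ _ (bits_mean e0 (fun f => 1 / 8 +
   (2 * (L (- a) f * L (- a) f) + (2 * (L a f * L a f) + (- 4) * (L (- a) f * L a f)))))).
  apply: ler_bits_mean => // f.
  have /andP[] := hg f; move: (g f) (L a f) (L (- a) f) => x u v x0 x1.
  (* Expanding the first square gives [v - u <= 1/8 + 2 (v - u)^2], which suffices for [v > u] as
     [x <= 1]; otherwise the left side is nonpositive. *)
  have H := sqr_ge0 (4 * (v - u) - 1); have H' := sqr_ge0 (4 * (v - u)).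
  have [uv|vu] := leP u v; nra.
rewrite bits_meanD bits_mean_cst bits_meanD bits_meanZ bits_meanD !bits_meanZ !LL.
by rewrite lerD2l !(mulNr, mulrN) opprK -expr2; lra.
Qed.

End BiasedBits.

(** With [w = m q], Bernoulli gives [(1 - q)^m >= 1 - w] and, in the division-free form [up],
    [(1 + q)^m <= 1 / (1 - w)], which is at most [1 + 2 w] for [w <= 1/2]. *)
Lemma exprD1_sub1_le (R : realFieldType) (q : R) (m : nat) :
  0 <= q -> m%:R * q <= 1 / 2 ->
  (1 + q) ^+ m - (1 - q) ^+ m <= 3 * (m%:R * q).
Proof.
move=> q0 mq.
have up k : k%:R * q <= 1 -> (1 + q) ^+ k * (1 - k%:R * q) <= 1.
  elim: k => [|k IH]; first by rewrite mul0r subr0 mulr1 expr0.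
  rewrite -natr1 => kq.
  have kq0 : 0 <= k%:R * q by rewrite mulr_ge0.
  have p0 : 0 <= (1 + q) ^+ k by rewrite exprn_ge0//; lra.
  apply: (le_trans _ (IH _)); last by lra.
  by rewrite exprSr -mulrA ler_wpM2l//; nra.
have lo k : k%:R * q <= 1 -> 1 - k%:R * q <= (1 - q) ^+ k.
  elim: k => [|k IH]; first by rewrite mul0r subr0 expr0.
  rewrite -natr1 => kq.
  have kq0 : 0 <= k%:R * q by rewrite mulr_ge0.
  have q1 : 0 <= 1 - q by lra.
  have := ler_wpM2r q1 (IH ltac:(lra)).
  by rewrite exprSr; apply: le_trans; nra.
have := up m ltac:(lra); have := lo m ltac:(lra).
have : 0 <= (1 + q) ^+ m by rewrite exprn_ge0//; lra.
have : 0 <= m%:R * q by rewrite mulr_ge0.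
by move: ((1 + q) ^+ m) ((1 - q) ^+ m) (m%:R * q) mq => u v x *; nra.
Qed.

(** * Product laws of biased bits as probability measures *)

Local Open Scope classical_set_scope.

(* An alias carrying the discrete sigma-algebra. *)
Definition bits (I : finType) := {ffun I -> bool}.
HB.instance Definition _ (I : finType) := Finite.on (bits I).
HB.instance Definition _ (I : finType) := isPointed.Build (bits I) [ffun=> true].
HB.instance Definition _ (I : finType) := @isMeasurable.Build default_measure_display
  (bits I) (@discrete_measurable _) (@discrete_measurable0 _)
  (@discrete_measurableC _) (@discrete_measurableU _).

Lemma measurable_bits (I : finType) (A : set (bits I)) : measurable A.
Proof. by []. Qed.

Lemma measurable_fun_bits (I : finType) d (X : measurableType d) (F : bits I -> X) :
  measurable_fun setT F.
Proof. by move=> _ B _; exact: measurable_bits. Qed.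

Section BitsMeasure.
Context {R : realType} {I : finType}.
Variable (e : I -> R).
Hypothesis he : forall i, `|e i| <= 1.

Let pt (k : nat) : bits I := nth point (enum (bits I)) k.

(** A finite sum of scaled Dirac masses, so that integrals collapse to the finite sums of
    [bits_mean]. *)
Definition bits_measure : set (bits I) -> \bar R :=
  msum (fun k => mscale (NngNum (bits_prob_ge0 (pt k) he)) (\d_(pt k)))
    #|bits I|.

HB.instance Definition _ := Measure.on bits_measure.

Lemma sum_pt (F : bits I -> \bar R) :
  (\sum_(k < #|bits I|) F (pt k) = \sum_f F f)%E.
Proof.
rewrite -(big_mkord xpredT (fun k => F (pt k))) cardE -(big_nth point xpredT).
by rewrite big_enum.
Qed.

Lemma bits_measureE A :
  bits_measure A = (\sum_f bits_prob e f * (f \in A)%:R)%:E.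
Proof.
rewrite /bits_measure /msum -sumEFin
  -(sum_pt (fun f => (bits_prob e f * (f \in A)%:R)%:E)).
by apply: eq_bigr => k _; rewrite EFinM -diracE.
Qed.

Lemma bits_measure_setT : bits_measure setT = 1%E.
Proof.
rewrite bits_measureE; congr EFin; rewrite -[RHS](bits_meanT e).
by apply: eq_bigr => f _; rewrite in_setT mulr1.
Qed.

HB.instance Definition _ :=
  Measure_isProbability.Build _ _ _ bits_measure bits_measure_setT.

Lemma integral_bits (F : bits I -> \bar R) : (forall f, 0 <= F f)%E ->
  (\int[bits_measure]_f F f = \sum_f (bits_prob e f)%:E * F f)%E.
Proof.
move=> F0; rewrite /bits_measure ge0_integral_measure_sum//.
rewrite -(sum_pt (fun f => (bits_prob e f)%:E * F f)%E); apply: eq_bigr => k _.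
by rewrite ge0_integral_mscale// integral_dirac// diracT mul1e.
Qed.

Variables (v : bool -> R).

Definition bit_rv_fun (i : I) (f : bits I) : R := v (f i).

Lemma bit_rv_measurable i : measurable_fun setT (bit_rv_fun i).
Proof. exact: measurable_fun_bits. Qed.

HB.instance Definition _ (i : I) :=
  isMeasurableFun.Build _ _ _ _ (bit_rv_fun i) (bit_rv_measurable i).

Definition bit_rv (i : I) : {RV bits_measure >-> R} := bit_rv_fun i.

Lemma bits_measure_all (A : I -> set R) :
  bits_measure [set f | forall i, A i (bit_rv i f)] =
  (\prod_i (bit_prob (e i) true * (v true \in A i)%:R +
            bit_prob (e i) false * (v false \in A i)%:R))%:E.
Proof.
rewrite bits_measureE -(bits_mean_prod e (fun i b => (v b \in A i)%:R)).
congr EFin; apply: eq_bigr => f _; congr (_ * _).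
have [|] := boolP (f \in _).
  by rewrite inE => /= fA; rewrite big1// => i _; rewrite mem_set//; exact: fA.
rewrite notin_setE /= => /existsNP[i fi].
by rewrite (bigD1 i)//= memNset ?mul0r.
Qed.

Lemma bits_measure_one i (A : set R) :
  bits_measure (bit_rv i @^-1` A) =
  (bit_prob (e i) true * (v true \in A)%:R +
   bit_prob (e i) false * (v false \in A)%:R)%:E.
Proof.
transitivity (bits_measure [set f |
    forall j, (if j == i then A else setT) (bit_rv j f)]).
  congr bits_measure; apply/seteqP; split => f /=.
    by move=> fA j; case: eqP => [->|].
  by move/(_ i); rewrite eqxx.
rewrite (bits_measure_all (fun j => if j == i then A else setT)).
rewrite (bigD1 i)//= eqxx big1 ?mulr1// => j /negbTE ->.
by rewrite !in_setT !mulr1; exact: (bit_probT _ true).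
Qed.

Lemma bit_rv_independent : mutually_independent bit_rv.
Proof.
move=> A mA; apply: (etrans (bits_measure_all A)).
by rewrite -prodEFin; apply: eq_bigr => i _; exact/esym/bits_measure_one.
Qed.

End BitsMeasure.

Section TwoPointLaw.
Context {R : realType}.
Variables (v : bool -> R) (x : R) (hx : `|x| <= 1).

(** Taken as the law of a one-bit family indexed by [unit], so that it is a probability by
    construction and [bits_measure_one] computes it. *)
Definition two_point_law : probability R R :=
  distribution (bits_measure (fun _ : unit => hx)) (bit_rv (fun=> hx) v tt).

Lemma two_point_lawE (A : set R) : two_point_law A =
  (bit_prob x true * (v true \in A)%:R + bit_prob x false * (v false \in A)%:R)%:E.
Proof. exact: bits_measure_one. Qed.

End TwoPointLaw.

Lemma bit_rv_has_law (R : realType) (I : finType) (e : I -> R)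
    (he : forall i, `|e i| <= 1) (v : bool -> R) (i : I) (x : R) (hx : `|x| <= 1) :
  e i = x -> has_law (bit_rv he v i) (two_point_law v hx).
Proof.
move=> ex A mA; rewrite two_point_lawE -ex; exact: bits_measure_one.
Qed.

(** * Trajectories *)

Section Trajectories.
Context {R : realType} {T : nat}.

Lemma past_prefix (pi : policy T) (x : R) (s : pol_seed pi) (D D' : 'I_T -> R)
    (t : nat) (tT : (t <= T)%N) : (forall i : 'I_T, (i < t)%N -> D i = D' i) ->
  past x s D tT = past x s D' tT.
Proof.
elim: t tT => [//|t IH] tT DD' /=.
by rewrite (IH (ltnW tT)) ?DD'//= => i it; apply: DD'; exact: ltnW.
Qed.

(** Non-anticipation: the history read by the rule is built from earlier demands only. It makes the
    order of period [t] independent of the demand of period [t]. *)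
Lemma order_level_prefix (pi : policy T) (x : R) (s : pol_seed pi)
    (D D' : 'I_T -> R) (t : 'I_T) : (forall i : 'I_T, (i < t)%N -> D i = D' i) ->
  order_level x s D t = order_level x s D' t.
Proof. by move=> DD'; rewrite /order_level (past_prefix _ _ _ DD'). Qed.

Lemma measurable_rcons d d' (X : measurableType d) (Y : measurableType d') n
    (H : X -> n.-tuple Y) (y : X -> Y) :
  measurable_fun setT H -> measurable_fun setT y ->
  measurable_fun setT (fun x => [tuple of rcons (H x) (y x)]).
Proof.
move=> mH my; apply/measurable_fun_tnthP => i.
have [i_n|n_i] := ltnP i n.
  rewrite (_ : _ \o _ = (fun x => tnth (H x) (Ordinal i_n))).
    exact: (measurableT_comp (measurable_tnth _)).
  apply/funext => x /=.
  by rewrite !(tnth_nth (y x)) /= nth_rcons size_tuple i_n.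
rewrite (_ : _ \o _ = y)//; apply/funext => x /=.
have in_ : i = n :> nat by apply/eqP; rewrite eqn_leq n_i -ltnS ltn_ord.
by rewrite (tnth_nth (y x)) /= nth_rcons size_tuple in_ ltnn eqxx.
Qed.

Section Returned.
Context {N : nat} (E : estimator (R := R) T N) (z : T.-tuple (N.-tuple R)).
Context {d : measure_display} {X : measurableType d}.
Variables (om : X -> est_seed E) (s : X -> est_pol_seed E) (D : X -> 'I_T -> R).
Hypothesis mom : measurable_fun setT om.
Hypothesis ms : measurable_fun setT s.
Hypothesis mD : forall t, measurable_fun setT (fun x => D x t).

Let pi x := returned_policy (e := E) (z, om x).

(** The policy itself varies with [x] through the learner seed, so the joint measurability of
    [est_rule] is what applies here, rather than [pol_meas] of one policy. *)
Lemma measurable_rule (t : 'I_T) (x0 : R) (H : X -> t.-tuple (R * R)) :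
  measurable_fun setT H ->
  measurable_fun setT (fun x => @pol_rule R T (pi x) t (s x, (x0, H x))).
Proof.
move=> mH; apply: (@measurableT_comp _ _ _ _ _ _ (@est_rule R T N E t) _
  (fun x => ((z, om x), (s x, (x0, H x))))); first exact: est_meas.
do 2?[apply: measurable_fun_pair => //]; first exact: measurable_fun_pair.
Qed.

Lemma measurable_past (x0 : R) (t : nat) (tT : (t <= T)%N) :
  measurable_fun setT (fun x => past (pi := pi x) x0 (s x) (D x) tT).
Proof.
elim: t tT => [|t IH] tT /=.
  exact: measurable_cst.
have mrule := measurable_rule (t := Ordinal tT) x0 (IH (ltnW tT)).
apply: measurable_rcons; first exact: IH.
apply: measurable_fun_pair => //.
exact: measurable_minr.
Qed.

Lemma measurable_order_level (x0 : R) (t : 'I_T) :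
  measurable_fun setT (fun x => order_level (pi := pi x) x0 (s x) (D x) t).
Proof. exact: measurable_rule (measurable_past _ _). Qed.

Lemma measurable_total_cost (x0 : R) (h p : 'I_T -> R) :
  measurable_fun setT (fun x => total_cost (pi := pi x) x0 (s x) (D x) h p).
Proof.
apply: measurable_sum => t.
have my := measurable_order_level x0 t.
apply: measurable_funD; apply: measurable_funM => //;
  apply: measurable_maxr => //; exact: measurable_funB.
Qed.

End Returned.
End Trajectories.

(** * Base-stock policies *)

Section BaseStock.
Context {R : realType} {T : nat}.
Variable (q : 'I_T -> R).

Let rule (t : 'I_T) (sH : unit * (R * t.-tuple (R * R))) :=
  Num.max (inventory sH.2) (q t).

Lemma measurable_inventory (t : nat) :
  measurable_fun [set: R * t.-tuple (R * R)] (@inventory R t).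
Proof.
rewrite /inventory; case: t => [|t].
  rewrite (_ : (fun _ => _) = fst); first exact: measurable_fst.
  by apply/funext => -[x H] /=; rewrite tuple0 /= subr0.
rewrite (_ : (fun _ => _) =
    (fun H : R * t.+1.-tuple (R * R) =>
       (tnth H.2 ord_max).1 - (tnth H.2 ord_max).2)); last first.
  apply/funext => -[x H] /=; rewrite (tnth_nth (x, 0)) /=.
  by rewrite (last_nth (x, 0)) size_tuple.
have mlast : measurable_fun [set: R * t.+1.-tuple (R * R)] (fun H => tnth H.2 ord_max).
  exact: (measurableT_comp (measurable_tnth ord_max) measurable_snd).
apply: measurable_funB; first exact: (measurableT_comp measurable_fst).
exact: (measurableT_comp measurable_snd).
Qed.

Let rule_meas t : measurable_fun setT (@rule t).
Proof.
apply: measurable_maxr => //; apply: measurableT_comp => //.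
exact: measurable_inventory.
Qed.

Let rule_feas (t : 'I_T) (s : unit) (H : history t) :
  inventory H <= rule (s, H).
Proof. by rewrite /rule le_max lexx. Qed.

Definition base_stock : policy T :=
  @Policy R T _ unit (dirac tt) rule rule_meas rule_feas.

(* Leftover stock never exceeds [u - l <= l], so the constraint [y >= x] is
   slack along the whole trajectory. *)
Lemma base_stock_order_level (l u : R) (D : 'I_T -> R) (s : pol_seed base_stock) :
  0 <= l -> u <= 2 * l -> (forall t, l <= D t) -> (forall t, l <= q t <= u) ->
  forall t, order_level (pi := base_stock) 0 s D t = q t.
Proof.
move=> l0 ul hD hq.
suff inv t (tT : (t <= T)%N) : (t < T)%N ->
    inventory (0, past (pi := base_stock) 0 s D tT) <= l.
  move=> t; rewrite /order_level /= /rule /=; apply/max_idPr.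
  by apply: le_trans (inv _ _ (ltn_ord t)) _; case/andP: (hq t).
elim: t tT => [|t IH] tT tT1; first by rewrite /inventory /= subr0.
rewrite /inventory /= last_rcons /= /rule /=.
have /max_idPr -> : inventory (0, past (pi := base_stock) 0 s D (ltnW tT))
    <= q (Ordinal tT).
  by apply: le_trans (IH _ tT) _; case/andP: (hq (Ordinal tT)).
have /andP[lq qu] := hq (Ordinal tT).
have : l <= Num.min (D (Ordinal tT)) (q (Ordinal tT)) by rewrite le_min hD.
lra.
Qed.

End BaseStock.

(** * The hard instances *)

Section HardInstance.
Context {R : realType} {T : nat}.
Implicit Types (a y : R) (b : bool) (sigma D : {ffun 'I_T -> bool}).

Definition demand_level b : R := if b then 2 / 3 else 1 / 3.

Definition demand_bias a sigma (t : 'I_T) : R := bsign (sigma t) * a.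

Definition archive_bias {N} a sigma (tj : 'I_T * 'I_N) : R :=
  demand_bias a sigma tj.1.

Definition rel_level y : R := Num.min 1 (Num.max 0 (3 * y - 1)).

(* Under the bias of sign [b] the optimal level is [demand_level b]; this is the
   distance to it of [y] clipped to [1/3, 2/3], in units of 1/3. *)
Definition rel_error b y : R := if b then 1 - rel_level y else rel_level y.

Lemma rel_level_itv y : 0 <= rel_level y <= 1.
Proof. by rewrite /rel_level ge_min lexx le_min ler01 le_max lexx. Qed.

Lemma rel_error_itv b y : 0 <= rel_error b y <= 1.
Proof. by have /andP[] := rel_level_itv y; case: b; rewrite /rel_error => ? ?; lra. Qed.

Lemma norm_bsignM a b : `|bsign b * a| = `|a|.
Proof. by case: b; rewrite /bsign ?mul1r ?mulN1r ?normrN. Qed.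

Lemma demand_bias_le1 a sigma t : 0 <= a <= 1 -> `|demand_bias a sigma t| <= 1.
Proof. by move=> /andP[a0 a1]; rewrite norm_bsignM ger0_norm. Qed.

(** The expected cost is linear of slope [a] in absolute value on [[1/3, 2/3]], an interval of
    length 1/3, with minimum [(1 - a) / 6] at the favoured end; outside, it grows at unit rate away
    from the interval. *)
Lemma newsvendor_excess a b y : 0 <= a <= 1 ->
  (1 - a) / 6 + a / 3 * rel_error b y <=
  bit_prob (bsign b * a) true * `|y - demand_level true| +
  bit_prob (bsign b * a) false * `|y - demand_level false|.
Proof.
rewrite /bit_prob /rel_error /rel_level /demand_level => /andP[a0 a1].
have [y1|y1] := leP (3 * y - 1) 0; have [y2|y2] := leP 1 (3 * y - 1).
- lra.
- rewrite (min_r ler01) !ler0_norm; [|lra|lra].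
  by case: b; rewrite /bsign; nra.
- rewrite !ger0_norm; [|lra|lra].
  by case: b; rewrite /bsign; nra.
- rewrite ler0_norm ?ger0_norm; [|lra|lra].
  by case: b; rewrite /bsign; nra.
Qed.

Lemma newsvendor_optimum a b :
  bit_prob (bsign b * a) true * `|demand_level b - demand_level true| +
  bit_prob (bsign b * a) false * `|demand_level b - demand_level false| =
  (1 - a) / 6.
Proof.
rewrite /bit_prob /demand_level; case: b; rewrite /bsign subrr normr0 mulr0.
  by rewrite add0r ger0_norm; [field|lra].
by rewrite addr0 ler0_norm; [field|lra].
Qed.

(** Since [Y] ignores bit [t], resampling that bit integrates out the demand of period [t] alone. *)
Lemma bits_mean_period a sigma (t : 'I_T) (Y : {ffun 'I_T -> bool} -> R) :
  (forall D, Y (flip t D) = Y D) ->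
  bits_mean (demand_bias a sigma) (fun D => `|Y D - demand_level (D t)|) =
  bits_mean (demand_bias a sigma) (fun D =>
    bit_prob (bsign (sigma t) * a) true * `|Y D - demand_level true| +
    bit_prob (bsign (sigma t) * a) false * `|Y D - demand_level false|).
Proof.
move=> YD; rewrite (bits_mean_resample t); congr bits_mean; apply/funext => D.
by rewrite YD flip_eq /demand_bias; case: (D t) => //=; rewrite addrC.
Qed.

Lemma expected_cost_ge a sigma (Y : 'I_T -> {ffun 'I_T -> bool} -> R) :
  0 <= a <= 1 -> (forall t D, Y t (flip t D) = Y t D) ->
  T%:R * ((1 - a) / 6) + a / 3 * bits_mean (demand_bias a sigma)
      (fun D => \sum_t rel_error (sigma t) (Y t D)) <=
  bits_mean (demand_bias a sigma) (fun D => \sum_t `|Y t D - demand_level (D t)|).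
Proof.
move=> ha YD; rewrite !bits_mean_sum mulr_sumr.
rewrite -[X in X%:R * _]card_ord mulr_natl -sumr_const -big_split /=.
apply: ler_sum => t _; rewrite bits_mean_period// -bits_meanZ.
rewrite -[X in X + _](bits_mean_cst (demand_bias a sigma)) -bits_meanD.
by apply: ler_bits_mean => [i|D]; [exact: demand_bias_le1|exact: newsvendor_excess].
Qed.

Lemma expected_cost_optimum a sigma :
  bits_mean (demand_bias a sigma)
    (fun D => \sum_t `|demand_level (sigma t) - demand_level (D t)|) =
  T%:R * ((1 - a) / 6).
Proof.
rewrite bits_mean_sum -[X in X%:R * _]card_ord mulr_natl -sumr_const.
apply: eq_bigr => t _; rewrite (bits_mean_period _ _ (Y := fun=> _))//.
by rewrite newsvendor_optimum bits_mean_cst.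
Qed.

Lemma total_cost1E (pi : policy T) x (s : pol_seed pi) (D : 'I_T -> R) :
  total_cost x s D (fun=> 1) (fun=> 1) = \sum_t `|order_level x s D t - D t|.
Proof.
apply: eq_bigr => t _; rewrite !mul1r /pos_part.
move: (order_level x s D t) (D t) => y d.
have [dy|yd] := leP d y.
  by rewrite max_l ?max_r ?ger0_norm ?addr0//; lra.
by rewrite max_r ?max_l ?ler0_norm ?add0r ?opprB//; lra.
Qed.

Lemma card_informative_cells (N m : nat) (t : 'I_T) : (m <= N)%N ->
  #|[set tj : 'I_T * 'I_N | (tj.1 == t) && (tj.2 < m)%N]%SET| = m.
Proof.
move=> mN.
have -> : [set tj : 'I_T * 'I_N | (tj.1 == t) && (tj.2 < m)%N]%SET =
    finset.setX [set t]%SET [set j : 'I_N | (j < m)%N]%SET.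
  by apply/setP => -[i j]; rewrite !inE.
rewrite cardsX cards1 mul1n.
rewrite (_ : [set j : 'I_N | (j < m)%N]%SET =
   [set widen_ord mN j | j : 'I_m]%SET); last first.
  apply/setP => j; rewrite inE; apply/idP/imsetP => [jm|[k _ ->]] /=.
    by exists (Ordinal jm) => //; apply: val_inj.
  exact: ltn_ord.
by rewrite card_imset ?card_ord// => i j /(congr1 val) /= /val_inj.
Qed.

(* Flipping [sigma t] changes the law of the archive only in the [m]
   uncensored entries of row [t], and changes no demand observed before
   period [t]. *)
Lemma two_hypotheses_error (N m : nat) a sigma (t : 'I_T)
    (Y : {ffun 'I_T * 'I_N -> bool} -> {ffun 'I_T -> bool} -> R) :
  (m <= N)%N -> 0 <= a <= 1 -> m%:R * a ^+ 2 <= 1 / 2 ->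
  (forall L D, Y L (flip t D) = Y L D) ->
  (forall L D (j : 'I_N), (m <= j)%N -> Y (flip (t, j) L) D = Y L D) ->
  7 / 8 - 12 * (m%:R * a ^+ 2) <=
  \sum_(sg <- [:: sigma; flip t sigma])
    bits_mean (archive_bias (N := N) a sg) (fun L =>
      bits_mean (demand_bias a sg) (fun D => rel_error (sg t) (Y L D))).
Proof.
move=> mN ha ma YD YL.
(* The sum is symmetric under exchanging [sigma] and [flip t sigma]. *)
wlog st : sigma / sigma t.
  move=> H; case st : (sigma t); first exact: H.
  have := H (flip t sigma); rewrite flipK flip_eq st => /(_ isT).
  by rewrite !big_cons !big_nil !addr0 [X in _ <= X -> _]addrC.
set sg' := flip t sigma.
have st' : sg' t = false by rewrite flip_eq st.
(* The demand bias with period [t] made neutral. As [Y] ignores the demand of period [t], the mean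
   level [G] is the same under both signs; only the archive law still distinguishes them. *)
pose e0 i := if i == t then 0 else demand_bias a sigma i.
pose G L := bits_mean e0 (fun D => rel_level (Y L D)).
have he0 i : `|e0 i| <= 1.
  by rewrite /e0; case: ifP; rewrite ?normr0// demand_bias_le1.
have biasN i : i != t -> demand_bias a sg' i = demand_bias a sigma i.
  by move=> it; rewrite /demand_bias flip_neq.
have GE L sg : sg \in [:: sigma; sg'] ->
    bits_mean (demand_bias a sg) (fun D => rel_level (Y L D)) = G L.
  move=> sgin; apply: (bits_mean_irrelevant (K := pred1 t)) => [i|i D] /=.
    rewrite /e0 => /[dup] it /negbTE ->.
    by move: sgin; rewrite !inE => /orP[] /eqP ->; rewrite ?biasN.
  by move=> /eqP ->; rewrite YD.
have Gitv L : 0 <= G L <= 1.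
  apply/andP; split.
    rewrite -(bits_mean_cst e0 0); apply: ler_bits_mean => // D.
    by case/andP: (rel_level_itv (Y L D)).
  rewrite -(bits_mean_cst e0 1); apply: ler_bits_mean => // D.
  by case/andP: (rel_level_itv (Y L D)).
rewrite !big_cons big_nil addr0 /rel_error st st' /=.
have -> : bits_mean (archive_bias a sigma) (fun L =>
      bits_mean (demand_bias a sigma) (fun D => 1 - rel_level (Y L D))) =
    1 - bits_mean (archive_bias a sigma) G.
  rewrite -bits_mean_1B; congr bits_mean; apply/funext => L.
  by rewrite bits_mean_1B GE// inE eqxx.
have -> : bits_mean (archive_bias a sg') (fun L =>
      bits_mean (demand_bias a sg') (fun D => rel_level (Y L D))) =
    bits_mean (archive_bias a sg') G.
  by congr bits_mean; apply/funext => L; rewrite GE// !inE eqxx orbT.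
pose J := [set tj : 'I_T * 'I_N | (tj.1 == t) && (tj.2 < m)%N]%SET.
(* A hybrid archive: flipped bias on the uncensored cells [J], original bias elsewhere. It differs
   from the flipped archive only at censored cells of row [t], which [Y] ignores. *)
pose e' (tj : 'I_T * 'I_N) :=
  if tj \in J then archive_bias a sg' tj else archive_bias a sigma tj.
have -> : bits_mean (archive_bias a sg') G = bits_mean e' G.
  apply: (bits_mean_irrelevant
      (K := [pred tj : 'I_T * 'I_N | (tj.1 == t) && (m <= tj.2)%N])) => -[i j] /=.
    rewrite /e' inE /= ltnNge; case: (eqVneq i t) => [->|it] /=.
      by move=> ->.
    by rewrite /archive_bias /= biasN.
  move=> L /andP[/eqP -> mj]; congr bits_mean; apply/funext => D.
  by rewrite YL.
have eJ tj : tj \in J -> e' tj = - a /\ archive_bias a sigma tj = - - a.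
  move=> tjJ; rewrite /e' tjJ opprK; move: tjJ; rewrite inE => /andP[/eqP tj1 _].
  by rewrite /archive_bias /demand_bias tj1 st st' /bsign mulN1r mul1r.
have eNJ tj : tj \notin J -> e' tj = archive_bias a sigma tj.
  by rewrite /e' => /negbTE ->.
have he' tj : `|e' tj| <= 1 by rewrite /e'; case: ifP => _; exact: demand_bias_le1.
(* The error sum is 1 minus the difference of the two means of [G], and that difference is at most
   [1/8 + 4 * 3 m a^2]. *)
have := bits_mean_indist eJ eNJ he' Gitv.
have := exprD1_sub1_le (sqr_ge0 a) ma.
rewrite sqrrN card_informative_cells//.
by move: (_ ^+ m - _) (bits_mean _ _) (bits_mean _ _) => u v w; lra.
Qed.

(** For each period, the sum over all sign vectors is grouped into pairs [sigma], [flip t sigma]; a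
    pair has total error at least [c], hence average at least [c / 2] per sign vector. *)
Lemma assouad (N m : nat) a
    (Y : 'I_T -> {ffun 'I_T * 'I_N -> bool} -> {ffun 'I_T -> bool} -> R) :
  (m <= N)%N -> 0 <= a <= 1 -> m%:R * a ^+ 2 <= 1 / 2 ->
  (forall t L D, Y t L (flip t D) = Y t L D) ->
  (forall t L D (j : 'I_N), (m <= j)%N -> Y t (flip (t, j) L) D = Y t L D) ->
  #|{ffun 'I_T -> bool}|%:R * (T%:R / 2 * (7 / 8 - 12 * (m%:R * a ^+ 2))) <=
  \sum_sigma bits_mean (archive_bias (N := N) a sigma) (fun L =>
     bits_mean (demand_bias a sigma)
       (fun D => \sum_t rel_error (sigma t) (Y t L D))).
Proof.
move=> mN ha ma YD YL.
set c := 7 / 8 - _.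
pose F t sigma := bits_mean (archive_bias (N := N) a sigma) (fun L =>
  bits_mean (demand_bias a sigma) (fun D => rel_error (sigma t) (Y t L D))).
have -> : \sum_sigma bits_mean (archive_bias (N := N) a sigma) (fun L =>
     bits_mean (demand_bias a sigma)
       (fun D => \sum_t rel_error (sigma t) (Y t L D))) = \sum_t \sum_sigma F t sigma.
  rewrite [RHS]exchange_big; apply: eq_bigr => sigma _.
  rewrite -bits_mean_sum; congr bits_mean; apply/funext => L.
  by rewrite bits_mean_sum.
have -> : #|{ffun 'I_T -> bool}|%:R * (T%:R / 2 * c) =
    \sum_(t < T) \sum_(sigma : {ffun 'I_T -> bool}) (c / 2).
  rewrite !sumr_const card_ord -[RHS]mulr_natl -[X in _ = _ * X]mulr_natl.
  by move: (#|_|%:R) => K; field.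
apply: ler_sum => t _.
have -> : \sum_sigma F t sigma = \sum_sigma (F t sigma + F t (flip t sigma)) / 2.
  by rewrite -mulr_suml big_split /= (sum_flip t (F t)); field.
apply: ler_sum => sigma _.
have := two_hypotheses_error sigma mN ha ma (YD t) (YL t).
by rewrite !big_cons big_nil addr0 -/c => ?; rewrite ler_pM2r ?invr_gt0.
Qed.
End HardInstance.

(** * Integral bounds and policy values on the hard instances *)

Lemma integral_probability_cst (R : realType) d (X : measurableType d)
    (P : probability X R) (c : R) : (\int[P]_x c%:E = c%:E)%E.
Proof.
rewrite integral_cst// -[RHS]mule1; congr (_ * _)%E.
exact: probability_setT.
Qed.

(** Pointwise, [f] is at most [c] plus [M] times the indicator of the complement of [S]. *)
Lemma integral_le_on_event (R : realType) d (X : measurableType d)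
    (P : probability X R) (f : X -> \bar R) (S : set X) (c M : R) :
  measurable_fun setT f -> measurable S -> (forall x, 0 <= f x <= M%:E)%E ->
  0 <= c -> 0 <= M -> (forall x, S x -> f x <= c%:E)%E ->
  (\int[P]_x f x <= (c + M * (1 - fine (P S)))%:E)%E.
Proof.
move=> mf mS fM c0 M0 fS.
have mSC : measurable (~` S) by exact: measurableC.
have mg : measurable_fun setT (fun x => (M * \1_(~` S) x)%:E).
  by apply/measurable_EFinP; exact: measurable_funM.
apply: (@le_trans _ _ (\int[P]_x (c%:E + (M * \1_(~` S) x)%:E))%E).
  apply: ge0_le_integral => //.
  - by move=> x _; case/andP: (fM x).
  - exact: emeasurable_funD.
  - move=> x _; have [Sx|Sx] := boolP (x \in S).
      apply: (le_trans (fS _ _)); first by rewrite inE in Sx.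
      by rewrite leeDl// lee_fin mulr_ge0.
    rewrite indicE in_setC Sx mulr1; apply: (@le_trans _ _ M%:E).
      by case/andP: (fM x).
    by rewrite leeDr// lee_fin.
rewrite ge0_integralD//; last by move=> x _; rewrite lee_fin mulr_ge0.
rewrite integral_probability_cst.
under eq_integral do rewrite EFinM.
rewrite ge0_integralZl_EFin//; last exact/measurable_EFinP.
rewrite integral_indic// setIT.
rewrite [X in (_ * X)%E](_ : _ = (1 - fine (P S))%:E).
  by rewrite -EFinM -EFinD.
rewrite EFinB fineK; last exact: fin_num_measure.
exact: probability_setC.
Qed.

Section Values.
Context {R : realType} {T : nat}.
Variables (a : R) (ha : 0 <= a <= 1) (sigma : {ffun 'I_T -> bool}).

Definition demand_rv : 'I_T -> {RV bits_measure (demand_bias_le1 sigma ^~ ha) >-> R} :=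
  bit_rv (demand_bias_le1 sigma ^~ ha) demand_level.

Definition demand_path (D : {ffun 'I_T -> bool}) (t : 'I_T) : R :=
  demand_level (D t).

Definition mean_cost (pi : policy T) (s : pol_seed pi) : R :=
  bits_mean (demand_bias a sigma)
    (fun D => \sum_t `|order_level 0 s (demand_path D) t - demand_level (D t)|).

Lemma value_bits (pi : policy T) :
  measurable_fun [set: pol_seed pi * bits 'I_T]
    (fun w => total_cost 0 w.1 (demand_path w.2) (fun=> 1) (fun=> 1)) ->
  value (fun=> 1) (fun=> 1) demand_rv pi 0 =
  (\int[pol_prob pi]_s (mean_cost s)%:E)%E.
Proof.
move=> mtc; rewrite /value fubini_tonelli1; last 2 first.
- exact/measurable_EFinP.
- move=> w; rewrite lee_fin total_cost1E.
  by apply: sumr_ge0.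
apply: eq_integral => s _; rewrite /fubini_F /= integral_bits; last first.
  by move=> D; rewrite lee_fin total_cost1E; exact: sumr_ge0.
rewrite /mean_cost /bits_mean -sumEFin; apply: eq_bigr => D _.
by rewrite total_cost1E EFinM.
Qed.

Lemma optimal_value_le :
  (optimal_value (fun=> 1%R) (fun=> 1%R) demand_rv 0 <= (T%:R * ((1 - a) / 6))%:E)%E.
Proof.
(* The witness knows the signs and aims at the favoured level in each period. *)
pose pi := base_stock (fun t => demand_level (R := R) (sigma t)).
have level D (s : pol_seed pi) t :
    order_level (pi := pi) 0 s (demand_path D) t = demand_level (sigma t).
  apply: (base_stock_order_level (l := 1 / 3) (u := 2 / 3)); [lra|lra| |] => i.
    by rewrite /demand_path /demand_level; case: (D i); lra.
  by rewrite /demand_level; case: (sigma i); lra.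
apply: ereal_inf_lbound; exists pi; rewrite value_bits.
  rewrite /mean_cost; under eq_integral => s _.
    under eq_fun do under eq_bigr do rewrite level.
    over.
  by rewrite expected_cost_optimum integral_probability_cst.
pose F (D : bits 'I_T) := \sum_t `|demand_level (R := R) (sigma t) - demand_level (D t)|.
suff -> : (fun w : pol_seed pi * bits 'I_T =>
    total_cost 0 w.1 (demand_path w.2) (fun=> 1) (fun=> 1)) = F \o snd.
  exact: (measurableT_comp (measurable_fun_bits F) measurable_snd).
apply/funext => -[s D]; rewrite total_cost1E /=.
apply: eq_bigr => t _; congr `|_ - _|; exact: level.
Qed.

(** Together with [optimal_value_le], this makes the optimal value finite, so that it can be
    subtracted in [success_seed_error]. *)
Lemma optimal_value_ge0 :
  (0 <= optimal_value (fun=> 1%R) (fun=> 1%R) demand_rv 0)%E.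
Proof.
apply: le_ereal_inf_tmp => _ [pi ->]; apply: integral_ge0 => w _.
by rewrite lee_fin total_cost1E; exact: sumr_ge0.
Qed.

End Values.

(** * The learner facing the hard archive *)

Section HardLearner.
Context {R : realType} {T N : nat}.
Variables (m : nat) (E : estimator (R := R) T N).

(** Boundary 1 exceeds both demand levels and reveals the demand; boundary 0 always logs 0. *)
Definition hard_bound (t : 'I_T) (j : 'I_N) : R := ((j < m)%N)%:R.

Definition hard_known : known T N :=
  Known (fun=> 1) (fun=> 1) (fun=> 1) hard_bound.

Lemma hard_known_admissible (r : R) : (0 < T)%N -> 0 <= r -> (m <= N)%N ->
  (m : int) = Num.ceil (r * N%:R) -> admissible_known r hard_known.
Proof.
move=> T0 r0 mN mE; split => //=.
- apply/eqP; rewrite eq_le; apply/andP; split.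
    by apply: bigmax_le => // t _; rewrite maxxx.
  by apply: (le_trans _ (le_bigmax_cond _ _ (j := Ordinal T0) _)) => //; rewrite maxxx.
- by move=> t; rewrite ler01 lexx.
- split=> [t j|t]; first by rewrite /hard_bound ler0n.
  rewrite -mE lez_nat.
  rewrite (_ : [set j | _]%SET = [set widen_ord mN j | j : 'I_m]%SET).
    by rewrite card_imset ?card_ord// => i j /(congr1 val) /= /val_inj.
  apply/setP => j; rewrite inE /hard_bound; apply/idP/imsetP => [|[k _ ->]] /=.
    by case: (ltnP j m) => [jm _|_]; [exists (Ordinal jm) => //; apply: val_inj|
       rewrite ler10].
  by rewrite ltn_ord.
Qed.

Definition hard_law (a : R) (ha : 0 <= a <= 1) (sigma : {ffun 'I_T -> bool})
    (t : 'I_T) : probability R R :=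
  two_point_law demand_level (demand_bias_le1 sigma t ha).

(** Both atoms lie strictly below the cap 1, so the left distribution function there is 1, above the
    critical ratio 1/2. *)
Lemma hard_law_admissible a ha sigma : admissible_laws hard_known (@hard_law a ha sigma).
Proof.
move=> t; split.
  rewrite /supported_on /hard_law two_point_lawE !mem_set ?mulr1.
  - by congr EFin; exact: (bit_probT _ true).
  - by rewrite /demand_level /= in_itv /=; apply/andP; split; lra.
  - by rewrite /demand_level /= in_itv /=; apply/andP; split; lra.
rewrite /cdf_left /hard_law two_point_lawE !mem_set ?mulr1 /=.
- by rewrite lte_fin [ltRHS](bit_probT _ true) ltr_pdivrMr ?mul1r ?ltrDl ?addr_gt0.
- by rewrite /demand_level /=; lra.
- by rewrite /demand_level /=; lra.
Qed.

Definition hard_logs (L : {ffun 'I_T * 'I_N -> bool}) : T.-tuple (N.-tuple R) :=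
  sales_logs hard_bound (fun t j => demand_level (L (t, j))).

Lemma hard_logs_flip (L : {ffun 'I_T * 'I_N -> bool}) (t : 'I_T) (j : 'I_N) :
  (m <= j)%N -> hard_logs (flip (t, j) L) = hard_logs L.
Proof.
move=> mj; apply: eq_from_tnth => t'; rewrite !tnth_mktuple.
apply: eq_from_tnth => j'; rewrite !tnth_mktuple.
have [jE|jn] := eqVneq (t', j') (t, j); last by rewrite flip_neq.
case: jE => -> ->; rewrite /hard_bound ltnNge mj /=.
by rewrite !min_r// /demand_level; case: ifP => _; lra.
Qed.

Definition learned_policy L (w : est_seed E) : policy T :=
  returned_policy (e := E) (hard_logs L, w).

Definition level_of (w : est_seed E * est_pol_seed E) (t : 'I_T)
    (L : {ffun 'I_T * 'I_N -> bool}) (D : {ffun 'I_T -> bool}) : R :=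
  order_level (pi := learned_policy L w.1) 0 w.2 (demand_path D) t.

Lemma level_of_flip w t L D : level_of w t L (flip t D) = level_of w t L D.
Proof.
apply: order_level_prefix => i it; rewrite /demand_path flip_neq//.
by rewrite neq_ltn it.
Qed.

Lemma level_of_flip_log w t L D (j : 'I_N) : (m <= j)%N ->
  level_of w t (flip (t, j) L) D = level_of w t L D.
Proof. by move=> mj; rewrite /level_of /learned_policy hard_logs_flip. Qed.

Lemma measurable_level_of t L D : measurable_fun setT (level_of ^~ t ^~ L ^~ D).
Proof.
exact: (@measurable_order_level R T N E (hard_logs L) _ _ fst snd
  (fun=> demand_path D)).
Qed.

Lemma measurable_rel_level : measurable_fun setT (@rel_level R).
Proof.
apply: measurable_minr => //; apply: measurable_maxr => //.
by apply: measurable_funB => //; exact: measurable_funM.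
Qed.

Lemma measurable_rel_error b : measurable_fun setT (@rel_error R b).
Proof.
case: b; last exact: measurable_rel_level.
by apply: measurable_funB => //; exact: measurable_rel_level.
Qed.

Lemma measurable_bits_mean (I : finType) (e : I -> R) d (X : measurableType d)
    (g : X -> {ffun I -> bool} -> R) :
  (forall f, measurable_fun setT (g ^~ f)) ->
  measurable_fun setT (fun x => bits_mean e (g x)).
Proof.
move=> mg; apply: measurable_sum => f; exact: measurable_funM.
Qed.

Section FixedBias.
Variables (a : R) (ha : 0 <= a <= 1) (sigma : {ffun 'I_T -> bool}).

Definition mean_error L (w : est_seed E * est_pol_seed E) : R :=
  bits_mean (demand_bias a sigma)
    (fun D => \sum_t rel_error (sigma t) (level_of w t L D)).

Lemma mean_error_itv L w : 0 <= mean_error L w <= T%:R.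
Proof.
have hb t := demand_bias_le1 sigma t ha.
apply/andP; split.
  rewrite -(bits_mean_cst (demand_bias a sigma) 0); apply: ler_bits_mean => // D.
  by apply: sumr_ge0 => t _; case/andP: (rel_error_itv (sigma t) (level_of w t L D)).
rewrite -(bits_mean_cst (demand_bias a sigma) T%:R); apply: ler_bits_mean => // D.
rewrite -[X in _ <= X%:R]card_ord -sumr_const; apply: ler_sum => t _.
by case/andP: (rel_error_itv (sigma t) (level_of w t L D)).
Qed.

Lemma measurable_mean_error L : measurable_fun setT (mean_error L).
Proof.
apply: measurable_bits_mean => D; apply: measurable_sum => t.
exact: measurableT_comp (measurable_rel_error _) (measurable_level_of _ _ _).
Qed.

(** Only the seed of the returned policy is averaged out; success is an event in the learner seed
    [w]. *)
Definition seed_error L (w : est_seed E) : \bar R :=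
  (\int[est_pol_prob E]_s (mean_error L (w, s))%:E)%E.

Lemma measurable_seed_error L : measurable_fun setT (seed_error L).
Proof.
rewrite (_ : seed_error L = fubini_F (est_pol_prob E)
    (fun w => (mean_error L w)%:E)); last by [].
apply: measurable_fun_fubini_tonelli_F.
  by apply/measurable_EFinP; exact: measurable_mean_error.
by move=> w; rewrite lee_fin; case/andP: (mean_error_itv L w).
Qed.

Lemma seed_error_itv L w : (0 <= seed_error L w <= T%:R%:E)%E.
Proof.
have me : measurable_fun setT (fun s => (mean_error L (w, s))%:E).
  apply/measurable_EFinP; exact: (measurable_fun_pair2 w (measurable_mean_error L)).
apply/andP; split.
  by apply: integral_ge0 => s _; rewrite lee_fin; case/andP: (mean_error_itv L (w, s)).
rewrite -(integral_probability_cst (est_pol_prob E)); apply: ge0_le_integral => //.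
- by move=> s _; rewrite lee_fin; case/andP: (mean_error_itv L (w, s)).
- by move=> s _; rewrite lee_fin; case/andP: (mean_error_itv L (w, s)).
Qed.

Definition learned_value L (w : est_seed E) : \bar R :=
  value (fun=> 1) (fun=> 1) (demand_rv ha sigma) (learned_policy L w) 0.

Definition learned_cost L (w : est_seed E * est_pol_seed E) : R :=
  mean_cost a sigma (pi := learned_policy L w.1) w.2.

Lemma learned_valueE L w : learned_value L w =
  (\int[est_pol_prob E]_s (learned_cost L (w, s))%:E)%E.
Proof.
rewrite /learned_value value_bits//.
apply: (@measurable_total_cost R T N E (hard_logs L) _
  (est_pol_seed E * bits 'I_T)%type (fun=> w) fst (fun x => demand_path x.2)) => // t.
exact: (measurableT_comp (measurable_fun_bits
  (fun D : bits 'I_T => demand_level (R := R) (D t))) measurable_snd).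
Qed.

Lemma learned_cost_ge0 L w : 0 <= learned_cost L w.
Proof.
rewrite -(bits_mean_cst (demand_bias a sigma) 0).
apply: ler_bits_mean => [t|D]; first exact: demand_bias_le1.
exact: sumr_ge0.
Qed.

Lemma measurable_learned_cost L : measurable_fun setT (learned_cost L).
Proof.
apply: measurable_bits_mean => D; apply: measurable_sum => t.
apply: measurableT_comp => //; apply: measurable_funB => //.
exact: measurable_level_of.
Qed.

Lemma measurable_learned_value L : measurable_fun setT (learned_value L).
Proof.
rewrite (_ : learned_value L = fubini_F (est_pol_prob E)
    (fun w => (learned_cost L w)%:E)); last first.
  by apply/funext => w; rewrite learned_valueE.
apply: measurable_fun_fubini_tonelli_F.
  by apply/measurable_EFinP; exact: measurable_learned_cost.
by move=> w; rewrite lee_fin learned_cost_ge0.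
Qed.

Lemma learned_value_ge L w :
  ((T%:R * ((1 - a) / 6))%:E + (a / 3)%:E * seed_error L w <= learned_value L w)%E.
Proof.
have /andP[a0 a1] := ha.
have a3 : 0 <= a / 3 by rewrite divr_ge0.
have c0 : 0 <= T%:R * ((1 - a) / 6) by rewrite mulr_ge0// divr_ge0// subr_ge0.
have e0 s : (0 <= (mean_error L (w, s))%:E)%E.
  by rewrite lee_fin; case/andP: (mean_error_itv L (w, s)).
have me : measurable_fun setT (fun s => (mean_error L (w, s))%:E).
  apply/measurable_EFinP; exact: (measurable_fun_pair2 w (measurable_mean_error L)).
rewrite learned_valueE -ge0_integralZl_EFin//.
rewrite -[X in (X + _)%E](integral_probability_cst (est_pol_prob E)) -ge0_integralD//.
- apply: ge0_le_integral => //.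
  + by move=> s _; rewrite adde_ge0// mule_ge0.
  + by apply: emeasurable_funD => //; exact: measurable_funeM.
  + apply/measurable_EFinP.
    exact: (measurable_fun_pair2 w (measurable_learned_cost L)).
  + move=> s _; rewrite -EFinM -EFinD lee_fin.
    apply: (expected_cost_ge sigma (Y := fun t D => level_of (w, s) t L D)) => //.
    by move=> t D; exact: level_of_flip.
- by move=> s _; rewrite mule_ge0.
- exact: measurable_funeM.
Qed.

Definition success L (eps : R) : set (est_seed E) :=
  [set w | eps_optimal (fun=> 1) (fun=> 1) (demand_rv ha sigma) eps 0
             (learned_policy L w)].

Lemma measurable_success L eps : measurable (success L eps).
Proof.
rewrite -[success _ _]setTI; apply: emeasurable_fun_infty_c => //.
apply: emeasurable_funB => //; exact: measurable_learned_value.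
Qed.

(** The learned value is at least [T (1 - a) / 6] plus [a / 3] times the error, while success caps
    it at [T (1 - a) / 6 + eps]. *)
Lemma success_seed_error L eps w : 0 < a -> success L eps w ->
  (seed_error L w <= (3 * eps / a)%:E)%E.
Proof.
move=> a0; rewrite /success /= /eps_optimal -/(learned_value L w).
have := learned_value_ge L w; have := optimal_value_le ha sigma.
have := optimal_value_ge0 ha sigma; have := seed_error_itv L w.
move: (seed_error L w) (optimal_value _ _ _ _) (learned_value L w).
(* The bounds in context exclude every infinite value; an infinite learned value contradicts success
   or its lower bound. *)
case=> [x||]; case=> [y||]; case=> [v||] //=; rewrite ?andbF//.
rewrite -EFinM -EFinD -EFinB !lee_fin => _ _ h1 h2 h3.
rewrite ler_pdivlMr//; lra.
Qed.

Lemma integral_seed_error L eps : 0 < a -> 0 <= eps ->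
  (\int[est_prob E]_w seed_error L w <=
   (3 * eps / a + T%:R * (1 - fine (est_prob E (success L eps))))%:E)%E.
Proof.
move=> a0 eps0; apply: integral_le_on_event => //.
- exact: measurable_seed_error.
- exact: measurable_success.
- exact: seed_error_itv.
- by rewrite divr_ge0 ?mulr_ge0// ltW.
- by move=> w; exact: success_seed_error.
Qed.

End FixedBias.
End HardLearner.

(** * Averaging over signs, archives and seeds *)

Section LowerBound.
Context {R : realType} {T N : nat}.
Variables (m : nat) (eps r a : R) (A : @learner R T N).
Hypotheses (T0 : (0 < T)%N) (r0 : 0 <= r) (mN : (m <= N)%N).
Hypothesis (mE : (m : int) = Num.ceil (r * N%:R)).
Hypotheses (ha : 0 <= a <= 1) (a0 : 0 < a) (eps0 : 0 <= eps).
Hypothesis learnsA : learns eps r A.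

Let E := A (hard_known m).

Lemma archive_bias_le1 sigma (tj : 'I_T * 'I_N) : `|archive_bias a sigma tj| <= 1.
Proof. exact: demand_bias_le1. Qed.

Lemma success_probability sigma :
  3 / 4 <= bits_mean (archive_bias a sigma)
    (fun L => fine (est_prob E (success m ha sigma L eps))).
Proof.
pose D := demand_rv ha sigma.
pose L := bit_rv (archive_bias_le1 sigma) demand_level.
have lawD t : has_law (D t) (hard_law ha sigma t) by exact: bit_rv_has_law.
have lawL t j : has_law (L (t, j)) (hard_law ha sigma t) by exact: bit_rv_has_law.
have := learnsA (hard_known_admissible T0 r0 mN mE) (hard_law_admissible m ha sigma)
  (bit_rv_independent _ _) lawD (bit_rv_independent _ _) lawL.
rewrite /product_measure1 integral_bits; last by move=> f; exact: measure_ge0.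
rewrite -lee_fin /bits_mean -sumEFin; congr (_ <= _)%E; apply: eq_bigr => f _.
rewrite EFinM fineK; last first.
  by apply: fin_num_measure; exact: measurable_success.
congr (_ * _)%E; congr (est_prob E _).
by rewrite xsectionE.
Qed.

(** Success costs at most [3 eps / a]; failure has probability at most 1/4 and costs at most [T]. *)
Lemma total_error_le sigma :
  (\sum_(L : {ffun 'I_T * 'I_N -> bool}) (bits_prob (archive_bias a sigma) L)%:E *
     \int[est_prob E \x est_pol_prob E]_w (mean_error m a sigma L w)%:E <=
   (3 * eps / a + T%:R / 4)%:E)%E.
Proof.
have P0 L : 0 <= bits_prob (archive_bias (N := N) a sigma) L.
  by apply: bits_prob_ge0; exact: archive_bias_le1.
apply: (@le_trans _ _ (\sum_(L : {ffun 'I_T * 'I_N -> bool})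
    (bits_prob (archive_bias a sigma) L * (3 * eps / a + T%:R *
     (1 - fine (est_prob E (success m ha sigma L eps)))))%:E)%E).
  apply: lee_sum => L _; rewrite EFinM lee_wpmul2l ?lee_fin//.
  rewrite fubini_tonelli1; first exact: integral_seed_error.
    by apply/measurable_EFinP; exact: measurable_mean_error.
  by move=> w; rewrite lee_fin; case/andP: (mean_error_itv m ha sigma L w).
rewrite sumEFin lee_fin.
rewrite -/(bits_mean _ (fun L => 3 * eps / a + T%:R *
     (1 - fine (est_prob E (success m ha sigma L eps))))).
rewrite bits_meanD bits_mean_cst bits_meanZ bits_mean_1B lerD2l.
by rewrite ler_wpM2l//; have := success_probability sigma; lra.
Qed.

(** The error summed over signs and integrated over both seeds is bounded below by [assouad], valid
    for each fixed pair of seeds, and above by [total_error_le]. *)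
Lemma bias_tradeoff : m%:R * a ^+ 2 <= 1 / 128 ->
  T%:R / 2 * (7 / 8 - 12 * (m%:R * a ^+ 2)) <= 3 * eps / a + T%:R / 4.
Proof.
move=> ma; set K := #|{ffun 'I_T -> bool}|%:R : R.
set c := T%:R / 2 * _; set c' := _ + _.
have K0 : 0 < K.
  by rewrite ltr0n; apply/card_gt0P; exists [ffun=> true].
rewrite -(ler_pM2l K0) -lee_fin.
pose G w := \sum_sigma bits_mean (archive_bias a sigma)
  (fun L => mean_error (E := E) m a sigma L w).
have Gc w : K * c <= G w.
  apply: (assouad (Y := fun t => level_of m w t) mN ha) => [|t L D|t L D j mj].
  - lra.
  - exact: level_of_flip.
  - exact: level_of_flip_log.
have P0 (sigma : {ffun 'I_T -> bool}) L :
    0 <= bits_prob (archive_bias (N := N) a sigma) L.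
  by apply: bits_prob_ge0; exact: archive_bias_le1.
have e0 sigma L w : (0 <= (mean_error (E := E) m a sigma L w)%:E)%E.
  by rewrite lee_fin; case/andP: (mean_error_itv m ha sigma L w).
have me sigma L : measurable_fun setT
    (fun w => (mean_error (E := E) m a sigma L w)%:E).
  by apply/measurable_EFinP; exact: measurable_mean_error.
have GE : (\int[est_prob E \x est_pol_prob E]_w (G w)%:E =
   \sum_(sigma : {ffun 'I_T -> bool}) \sum_(L : {ffun 'I_T * 'I_N -> bool})
     (bits_prob (archive_bias a sigma) L)%:E *
     \int[est_prob E \x est_pol_prob E]_w (mean_error m a sigma L w)%:E)%E.
  under eq_integral => w _.
    rewrite /G /bits_mean -sumEFin.
    under eq_bigr do (rewrite -sumEFin; under eq_bigr do rewrite EFinM).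
    over.
  rewrite ge0_integral_sum//=.
  - apply: eq_bigr => sigma _; rewrite ge0_integral_sum//=.
    + by apply: eq_bigr => L _; rewrite ge0_integralZl_EFin.
    + by move=> L; exact: measurable_funeM.
    + by move=> L w _; apply: mule_ge0 => //; rewrite lee_fin.
  - move=> sigma; apply: emeasurable_sum => L; exact: measurable_funeM.
  - by move=> sigma w _; apply: sume_ge0 => L _; apply: mule_ge0 => //;
      rewrite lee_fin.
apply: (@le_trans _ _ (\int[est_prob E \x est_pol_prob E]_w (G w)%:E)%E).
  have c0 : 0 <= K * c.
    by apply: mulr_ge0; [exact: ltW|apply: mulr_ge0; [rewrite divr_ge0|lra]].
  rewrite -(integral_probability_cst (est_prob E \x est_pol_prob E)%E (K * c)).
  apply: ge0_le_integral => //.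
  - apply/measurable_EFinP; apply: measurable_sum => sigma.
    apply: measurable_bits_mean => L; exact: measurable_mean_error.
  - by move=> w _; rewrite lee_fin.
rewrite GE; apply: (@le_trans _ _ (\sum_(sigma : {ffun 'I_T -> bool}) c'%:E)%E).
  by apply: lee_sum => sigma _; exact: total_error_le.
by rewrite sumEFin lee_fin sumr_const -mulr_natl.
Qed.
End LowerBound.

(* Numerical constants and the sample-size bound *)
Local Close Scope classical_set_scope.

(* [46137344] is a [Nat.of_num_uint] numeral, whose unary normal form must not
   be computed; this bounds it from below digit by digit. *)
Lemma of_uint_acc_ge (d : Decimal.uint) (n : nat) :
  (n * 10 ^ Decimal.nb_digits d <= Nat.of_uint_acc d n)%N.
Proof.
have tail_addE p q : Nat.tail_add p q = (p + q)%N.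
  by elim: p q => //= p IH q; rewrite IH addSnnS.
have tail_mulE q : Nat.tail_mul 10 q = (10 * q)%N.
  by rewrite /Nat.tail_mul /= !tail_addE; lia.
elim: d n => [|d IH|d IH|d IH|d IH|d IH|d IH|d IH|d IH|d IH|d IH] n;
  rewrite /= ?muln1// ?tail_mulE; apply: leq_trans (IH _);
  by rewrite expnS mulnA leq_mul2r; lia.
Qed.

Lemma denominator_ge : (512 * 1024 <= 46137344)%N.
Proof.
have of_uintE d : Nat.of_num_uint (Number.UIntDecimal (Decimal.D4 d)) =
  Nat.of_uint_acc d 4 by [].
rewrite of_uintE; set d := (X in Nat.of_uint_acc X _).
(* Seven digits follow the leading 4; the split reduces the claim to [512 <= 4 * 10 ^ 3] and
   [1024 <= 10 ^ 4]. *)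
have dE : Decimal.nb_digits d = (3 + 4)%N by [].
apply: leq_trans (of_uint_acc_ge d 4); rewrite {}dE expnD mulnA.
by apply: leq_mul.
Qed.

(* The factor 2 keeps the final inequality strict after taking the infimum. *)
Lemma learner_sample_size (R : realType) (T N : nat) (r eps K : R)
    (A : @learner R T N) :
  (0 < T)%N -> 0 < r -> r <= 1 -> 0 < eps -> eps <= T%:R / 512 ->
  learns eps r A -> 0 < K -> 512 * 1024 <= K ->
  2 * T%:R ^+ 2 / (K * r * eps ^+ 2) <= N%:R.
Proof.
move=> T0 r0 r1 eps0 epsT learnsA K0.
have T0' : 0 < T%:R :> R by rewrite ltr0n.
have rN0 : 0 <= r * N%:R by rewrite mulr_ge0// ltW.
pose m := `|Num.ceil (r * N%:R)|%N.
have mE : (m : int) = Num.ceil (r * N%:R).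
  by rewrite /m gez0_abs// -(ceil0 R) le_ceil.
have mN : (m <= N)%N.
  by rewrite -lez_nat mE ceil_le_int -pmulrn ler_piMl.
have m_lt : m%:R < r * N%:R + 1.
  by have := ceilB1_lt (r * N%:R); rewrite -mE intrB -pmulrn; lra.
pose x := eps / T%:R.
have x0 : 0 < x by rewrite divr_gt0.
have x1 : x <= 1 / 512 by rewrite ler_pdivrMr//; lra.
(* The bias is [a = 32 x = 32 eps / T], which makes [3 eps / a] equal to [3 T / 32]. *)
have a0 : 0 < 32 * x by lra.
have a16 : 32 * x <= 1 / 16 by lra.
have ha : 0 <= 32 * x <= 1 by apply/andP; split; lra.
have a2 : (32 * x) ^+ 2 <= 1 / 16 * (1 / 16).
  by rewrite expr2 ler_pM// ltW.
have xE : 3 * eps / (32 * x) = 3 / 32 * T%:R.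
  by rewrite /x; field; rewrite !gt_eqF.
move=> hK; rewrite leNgt; apply/negP => NT.
have rNx : K * (r * N%:R * x ^+ 2) <= 2.
  move: NT; rewrite ltr_pdivlMr; last by rewrite !mulr_gt0// exprn_gt0.
  move=> /ltW NT; rewrite /x expr_div_n !mulrA ler_pdivrMr ?exprn_gt0//.
  by apply: le_trans NT; rewrite le_eqVlt; apply/orP; left; apply/eqP; ring.
have rNx0 : 0 <= r * N%:R * x ^+ 2 by rewrite mulr_ge0// sqr_ge0.
have {rNx NT}rNx := le_trans (ler_wpM2r rNx0 hK) rNx.
clear hK.
(* The term in [r N] is at most [1024 * 2 / (512 * 1024) = 1/256], and the rounding of [m] adds at
   most [a^2 <= 1/256]. *)
have mx : m%:R * (32 * x) ^+ 2 <= 1 / 128.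
  apply: (@le_trans _ _ ((r * N%:R + 1) * (32 * x) ^+ 2)).
    by rewrite ler_wpM2r ?sqr_ge0// ltW.
  rewrite mulrDl mul1r.
  have -> : r * N%:R * (32 * x) ^+ 2 = 1024 * (r * N%:R * x ^+ 2) by ring.
  move: rNx; rewrite -[512 * 1024 * _]mulrA; move: (1024 * _) ((32 * x) ^+ 2) a2 => u v.
  by clear; lra.
clear rNx; have := bias_tradeoff T0 (ltW r0) mN mE ha a0 (ltW eps0) learnsA mx.
(* For [y <= 1/128] the left side is at least [25 T / 64], while the right side is
   [3 T / 32 + T / 4 = 22 T / 64]. *)
rewrite xE; move: (m%:R * _) mx => y mx.
have : 0 <= T%:R * (1 / 128 - y) by rewrite mulr_ge0//; lra.
by move: mx T0'; clear; move: (T%:R) => t; lra.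
Qed.

(** An abstract constant [K] keeps the large numeral out of the arithmetic. The bound on every
    feasible [N] passes to the infimum, which is [+oo] if there is none. *)
Lemma M_cov_star_gt (R : realType) (T : nat) (r eps K : R) :
  (0 < T)%N -> 0 < r -> r <= 1 -> 0 < eps -> eps <= T%:R / 512 ->
  512 * 1024 <= K -> ((T%:R ^+ 3 / (K * r * eps ^+ 2))%:E < M_cov_star T eps r)%E.
Proof.
move=> T0 r0 r1 eps0 epsT hK.
have K0 : 0 < K.
  by apply: lt_le_trans hK; apply: mulr_gt0; rewrite ltr0n.
have T0' : 0 < T%:R :> R by rewrite ltr0n.
have d0 : 0 < K * r * eps ^+ 2 by rewrite !mulr_gt0// exprn_gt0.
apply: (@lt_le_trans _ _ (T%:R * (2 * T%:R ^+ 2 / (K * r * eps ^+ 2)))%:E).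
  rewrite lte_fin mulrA ltr_pM2r ?invr_gt0// mulrCA -exprS.
  by rewrite ltr_pMl ?exprn_gt0// ltr1n.
rewrite EFinM lee_wpmul2l ?lee_fin//.
apply: le_ereal_inf_tmp => _ [N [_ [A learnsA]] <-]; rewrite lee_fin.
exact: learner_sample_size T0 r0 r1 eps0 epsT learnsA K0 hK.
Qed.

Theorem proposition1 (R : realType) (T : nat) (r eps : R)
    (T_ge4 : (4 <= T)%N) (T_even : ~~ odd T)
    (r_gt0 : 0 < r) (r_le1 : r <= 1)
    (eps_gt0 : 0 < eps) (eps_le : eps <= T%:R / 512) :
  ((T%:R ^+ 3 / (46137344%:R * r * eps ^+ 2))%:E < M_cov_star T eps r)%E.
Proof.
have T_gt0 := leq_trans (isT : (0 < 4)%N) T_ge4.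
apply: (M_cov_star_gt T_gt0 r_gt0 r_le1 eps_gt0 eps_le).
by rewrite -natrM ler_nat; exact: denominator_ge.
Qed.
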